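(* Let $\hat{\boldsymbol\beta}(z)$, $\boldsymbol s(z)$, $\mathcal A_z$, $\mathcal A_z^c$ be the Lasso solution, its subgradient vector, its active set and its inactive set for the parametrized response $\boldsymbol y(z)=\boldsymbol a+\boldsymbol b z$, $z\in\mathbb R$, with design matrix $X\in\mathbb R^{n\times p}$ and regularization parameter $\lambda\ge 0$ (as defined in the context). Let $z,z'\in\mathbb R$ with $z'>z$. Suppose that $|s_j(z)|<1$ for all $j\in\mathcal A_z^c$, that $|s_j(z')|<1$ for all $j\in\mathcal A_{z'}^c$, and that $X_{\mathcal A_z}^\top X_{\mathcal A_z}$ is invertible. If $\hat{\boldsymbol\beta}_{\mathcal A_z}(z)$ and $\hat{\boldsymbol\beta}_{\mathcal A_{z'}}(z')$ have the same active set and the same signs (i.e. $\mathcal A_z=\mathcal A_{z'}$ and $\operatorname{sign}(\hat\beta_j(z))=\operatorname{sign}(\hat\beta_j(z'))$ for all $j\in\mathcal A_z$), then $$\hat{\boldsymbol\beta}_{\mathcal A_z}(z')-\hat{\boldsymbol\beta}_{\mathcal A_z}(z)=\boldsymbol\psi_{\mathcal A_z}(z)\,(z'-z),$$ $$\lambda\,\boldsymbol s_{\mathcal A_z^c}(z')-\lambda\,\boldsymbol s_{\mathcal A_z^c}(z)=\boldsymbol\gamma_{\mathcal A_z^c}(z)\,(z'-z),$$ where $$\boldsymbol\psi_{\mathcal A_z}(z)=(X_{\mathcal A_z}^\top X_{\mathcal A_z})^{-1}X_{\mathcal A_z}^\top\boldsymbol b,\qquad \boldsymbol\gamma_{\mathcal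 A_z^c}(z)=X_{\mathcal A_z^c}^\top\boldsymbol b-X_{\mathcal A_z^c}^\top X_{\mathcal A_z}\boldsymbol\psi_{\mathcal A_z}(z).$$
   Context: Data: $X\in\mathbb R^{n\times p}$ is a feature matrix, $\boldsymbol y^{\rm obs}\in\mathbb R^n$ an observed response, $\Sigma\in\mathbb R^{n\times n}$ a covariance matrix, $\lambda\ge 0$. For an index set $S\subseteq\{1,\dots,p\}$, $X_S$ is the submatrix of $X$ with columns indexed by $S$, and $\boldsymbol v_S$ is the subvector of $\boldsymbol v$ with entries indexed by $S$. Line in data space: let $\mathcal A_{\rm obs}$ be the set of indices of nonzero entries of the Lasso solution $\arg\min_{\boldsymbol\beta\in\mathbb R^p}\frac12\|\boldsymbol y^{\rm obs}-X\boldsymbol\beta\|_2^2+\lambda\|\boldsymbol\beta\|_1$. Fix one selected feature and let $\boldsymbol e\in\mathbb R^{|\mathcal A_{\rm obs}|}$ be the standard basis vector with a 1 in the position of that feature. Put $\boldsymbol\eta=X_{\mathcal A_{\rm obs}}(X_{\mathcal A_{\rm obs}}^\top X_{\mathcal A_{\rm obs}})^{-1}\boldsymbol e$ (the inverse is assumed to exist, and $\boldsymbol\eta^\top\Sigma\boldsymbol\eta>0$), $\boldsymbol b=\Sigma\boldsymbol\eta(\boldsymbol\eta^\top\Sigma\boldsymbol\eta)^{-1}\in\mathbb R^n$, $\boldsymbol a=(I_n-\boldsymbol b\boldsymbol\eta^\top)\boldsymbol y^{\rm obs}\in\mathbb R^n$, and $\boldsymbol y(z)=\boldsymbol a+\boldsymbol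 b z$ for $z\in\mathbb R$. Parametrized Lasso: for each $z\in\mathbb R$, $$\hat{\boldsymbol\beta}(z)=\arg\min_{\boldsymbol\beta\in\mathbb R^p}\tfrac12\|\boldsymbol y(z)-X\boldsymbol\beta\|_2^2+\lambda\|\boldsymbol\beta\|_1,$$ where the minimizer is assumed to be unique for every $z\in\mathbb R$. The vector $\boldsymbol s(z)\in\mathbb R^p$ is a subgradient of $\|\cdot\|_1$ at $\hat{\boldsymbol\beta}(z)$, i.e. $s_j(z)=\operatorname{sign}(\hat\beta_j(z))$ if $\hat\beta_j(z)\ne0$ and $s_j(z)\in[-1,1]$ if $\hat\beta_j(z)=0$, satisfying the optimality condition $X^\top(X\hat{\boldsymbol\beta}(z)-\boldsymbol y(z))+\lambda\boldsymbol s(z)=0$. The active set is $\mathcal A_z=\{j:\hat\beta_j(z)\neq0\}$ and the inactive set is $\mathcal A_z^c=\{1,\dots,p\}\setminus\mathcal A_z$. *)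

(* Defs.v *)
From mathcomp Require Import all_boot all_order all_algebra.
From mathcomp Require Import reals.

Set Implicit Arguments.
Unset Strict Implicit.
Unset Printing Implicit Defensive.

Import Order.TTheory GRing.Theory Num.Theory.
Local Open Scope ring_scope.

(* X_S and v_S: the indices of S are listed in increasing order by
   [enum_val : 'I_#|S| -> 'I_p]. *)
Definition cols {R : realType} {n p : nat} (S : {set 'I_p}) (X : 'M[R]_(n, p))
  : 'M[R]_(n, #|S|) := colsub (@enum_val _ (mem S)) X.

Definition subvec {R : realType} {p : nat} (S : {set 'I_p}) (v : 'cV[R]_p)
  : 'cV[R]_#|S| := rowsub (@enum_val _ (mem S)) v.

Definition gram {R : realType} {n p : nat} (S : {set 'I_p}) (X : 'M[R]_(n, p))
  : 'M[R]_#|S| := (cols S X)^T *m cols S X.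

Definition qform {R : realType} {n : nat} (M : 'M[R]_n) (v : 'cV[R]_n) : R :=
  (v^T *m M *m v) 0 0.

Definition covariance_matrix {R : realType} {n : nat} (M : 'M[R]_n) : Prop :=
  M^T = M /\ forall v : 'cV[R]_n, 0 <= qform M v.

Definition l2norm {R : realType} {n : nat} (v : 'cV[R]_n) : R :=
  Num.sqrt (\sum_i v i 0 ^+ 2).

Definition l1norm {R : realType} {n : nat} (v : 'cV[R]_n) : R :=
  \sum_i `|v i 0|.

Definition lasso_obj {R : realType} {n p : nat} (X : 'M[R]_(n, p)) (lambda : R)
    (y : 'cV[R]_n) (beta : 'cV[R]_p) : R :=
  2^-1 * l2norm (y - X *m beta) ^+ 2 + lambda * l1norm beta.

Definition lasso_solution {R : realType} {n p : nat} (X : 'M[R]_(n, p))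
    (lambda : R) (y : 'cV[R]_n) (beta : 'cV[R]_p) : Prop :=
  forall beta' : 'cV[R]_p,
    lasso_obj X lambda y beta <= lasso_obj X lambda y beta'.

Definition unique_lasso_solution {R : realType} {n p : nat} (X : 'M[R]_(n, p))
    (lambda : R) (y : 'cV[R]_n) (beta : 'cV[R]_p) : Prop :=
  lasso_solution X lambda y beta /\
  forall beta' : 'cV[R]_p, lasso_solution X lambda y beta' -> beta' = beta.

Definition l1_subgradient {R : realType} {p : nat} (beta s : 'cV[R]_p) : Prop :=
  forall j, if beta j 0 != 0 then s j 0 = Num.sg (beta j 0)
            else -1 <= s j 0 <= 1.

Definition active {R : realType} {p : nat} (beta : 'cV[R]_p) : {set 'I_p} :=
  [set j | beta j 0 != 0].

(* X_S (X_S^T X_S)^-1 e, where e is the standard basis vector of R^|S| with its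
   1 at the position occupied by feature j in the enumeration of S. *)
Definition test_direction {R : realType} {n p : nat} (X : 'M[R]_(n, p))
    (S : {set 'I_p}) (j : 'I_p) : 'cV[R]_n :=
  cols S X *m invmx (gram S X) *m (\col_k (enum_val k == j)%:R).

Definition line_dir {R : realType} {n : nat} (Sigma : 'M[R]_n) (eta : 'cV[R]_n)
  : 'cV[R]_n := (qform Sigma eta)^-1 *: (Sigma *m eta).

Definition line_base {R : realType} {n : nat} (Sigma : 'M[R]_n)
    (eta yobs : 'cV[R]_n) : 'cV[R]_n :=
  (1%:M - line_dir Sigma eta *m eta^T) *m yobs.

Definition psi {R : realType} {n p : nat} (X : 'M[R]_(n, p)) (b : 'cV[R]_n)
    (A : {set 'I_p}) : 'cV[R]_#|A| :=
  invmx (gram A X) *m (cols A X)^T *m b.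

Definition gamma {R : realType} {n p : nat} (X : 'M[R]_(n, p)) (b : 'cV[R]_n)
    (A : {set 'I_p}) : 'cV[R]_#|~: A| :=
  (cols (~: A) X)^T *m b - (cols (~: A) X)^T *m cols A X *m psi X b A.

(* Main.v *)
(* Subtracting the optimality conditions at the two parameters cancels the
   subgradient on the common active set, where it is the common sign vector;
   what remains is a linear system for the difference of the solutions, which is
   supported on that set. *)

Require Import Defs.
From mathcomp Require Import all_boot all_order all_algebra.
From mathcomp Require Import reals.

Set Implicit Arguments.
Unset Strict Implicit.
Unset Printing Implicit Defensive.

Import Order.TTheory GRing.Theory Num.Theory.
Local Open Scope ring_scope.

(** In each row sum the terms with index outside [S] vanish, and [enum_val] reindexes the remaining
    ones. *)
Lemma mulmx_cols {R : realType} {n p : nat} (S : {set 'I_p})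
    (X : 'M[R]_(n, p)) (v : 'cV[R]_p) :
  (forall j, j \notin S -> v j 0 = 0) -> X *m v = cols S X *m subvec S v.
Proof.
move=> v0; apply/matrixP => i k; rewrite ord1 !mxE.
rewrite (bigID (mem S)) /= [X in _ + X]big1 ?addr0; last first.
  by move=> j /v0 ->; rewrite mulr0.
by rewrite big_enum_val; apply: eq_bigr => j _; rewrite !mxE.
Qed.

Lemma subvec_trmul {R : realType} {n p : nat} (S : {set 'I_p})
    (X : 'M[R]_(n, p)) (u : 'cV[R]_n) :
  subvec S (X^T *m u) = (cols S X)^T *m u.
Proof.
by apply/matrixP => i k; rewrite !mxE; apply: eq_bigr => j _; rewrite !mxE.
Qed.

(** Rows indexed by [S] do not see [g], so they form a Gram system that determines [subvec S d]; the
    rows of the complement then give [g]. It is applied with [d] the difference of the solutions and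
    [g] that of the subgradients scaled by [lambda]. *)
Lemma linear_system_on_support {R : realType} {n p : nat} (S : {set 'I_p})
    (X : 'M[R]_(n, p)) (b : 'cV[R]_n) (t : R) (d g : 'cV[R]_p) :
  gram S X \in unitmx ->
  (forall j, j \notin S -> d j 0 = 0) ->
  (forall j, j \in S -> g j 0 = 0) ->
  X^T *m (X *m d - t *: b) + g = 0 ->
  subvec S d = t *: psi X b S /\ subvec (~: S) g = t *: gamma X b S.
Proof.
move=> Su d0 g0 /eqP; rewrite addrC addr_eq0 => /eqP gE.
(* [T] is left arbitrary: [S] gives the system for [d], and [~: S] gives the formula for [g]. *)
have restrict T : subvec T g =
    (cols T X)^T *m (t *: b - cols S X *m subvec S d).
  by rewrite -(mulmx_cols _ d0) -subvec_trmul gE -mulmxN opprB.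
have gS : subvec S g = 0.
  by apply/matrixP => i k; rewrite ord1 !mxE g0 ?enum_valP.
have dS : subvec S d = t *: psi X b S.
  move: gS; rewrite restrict mulmxBr mulmxA => /eqP.
  rewrite subr_eq0 => /eqP dE.
  (* Once [t] is moved onto [b], [dE] exposes the Gram matrix next to its inverse. *)
  by rewrite /psi -mulmxA scalemxAr [t *: (_ *m b)]scalemxAr dE mulKmx.
split=> //; rewrite restrict dS /gamma.
by rewrite -scalemxAr -scalerBr -scalemxAr mulmxBr mulmxA.
Qed.

Theorem lemma1 (R : realType) (n p : nat) (X : 'M[R]_(n, p))
    (yobs : 'cV[R]_n) (Sigma : 'M[R]_n) (lambda : R)
    (beta_obs : 'cV[R]_p) (jsel : 'I_p) (beta s : R -> 'cV[R]_p) (z z' : R) :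
  let Aobs := active beta_obs in
  let eta := test_direction X Aobs jsel in
  let b := line_dir Sigma eta in
  let a := line_base Sigma eta yobs in
  let y := fun t : R => a + t *: b in
  let A := fun t : R => active (beta t) in
  0 <= lambda ->
  covariance_matrix Sigma ->
  lasso_solution X lambda yobs beta_obs ->
  jsel \in Aobs ->
  gram Aobs X \in unitmx ->
  0 < qform Sigma eta ->
  (forall t : R, unique_lasso_solution X lambda (y t) (beta t)) ->
  (forall t : R, l1_subgradient (beta t) (s t)) ->
  (forall t : R, X^T *m (X *m beta t - y t) + lambda *: s t = 0) ->
  z < z' ->
  (forall j : 'I_p, j \in ~: A z -> `|s z j 0| < 1) ->
  (forall j : 'I_p, j \in ~: A z' -> `|s z' j 0| < 1) ->
  gram (A z) X \in unitmx ->
  A z = A z' ->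
  (forall j : 'I_p, j \in A z -> Num.sg (beta z j 0) = Num.sg (beta z' j 0)) ->
  subvec (A z) (beta z') - subvec (A z) (beta z) = (z' - z) *: psi X b (A z)
  /\ lambda *: subvec (~: A z) (s z') - lambda *: subvec (~: A z) (s z)
     = (z' - z) *: gamma X b (A z).
Proof.
move=> Aobs eta b a y A _ _ _ _ _ _ _ subg kkt _ _ _ Au AA sgE.
have d0 j : j \notin A z -> (beta z' - beta z) j 0 = 0.
  (* Two copies of the membership are kept, so that both coefficients are known to vanish. *)
  move=> jA; have := jA; rewrite AA; move: jA.
  by rewrite !inE !negbK !mxE => /eqP -> /eqP ->; rewrite subrr.
(* The factor [lambda] is never divided out, so [lambda = 0] is covered. *)
have g0 j : j \in A z -> (lambda *: (s z' - s z)) j 0 = 0.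
  move=> jA; have := jA; rewrite AA; have := jA.
  rewrite !inE !mxE => bz bz'; have := subg z j; have := subg z' j.
  by rewrite bz bz' => -> ->; rewrite sgE // subrr mulr0.
have sys : X^T *m (X *m (beta z' - beta z) - (z' - z) *: b) +
    lambda *: (s z' - s z) = 0.
  (* The base point [a] cancels along the line. *)
  have <- : y z' - y z = (z' - z) *: b.
    by rewrite /y opprD addrACA subrr add0r scalerBl.
  (* The right-hand side becomes [0 - 0], and its two zeros are expanded into the optimality
     conditions at [z'] and [z]. *)
  rewrite -[RHS](subrr 0) -{1}(kkt z') -(kkt z).
  rewrite scalerBr [- (_ + lambda *: _)]opprD addrACA -mulmxBr.
  by congr (_ *m _ + _); rewrite mulmxBr !opprD addrACA.
have [dE gE] := linear_system_on_support Au d0 g0 sys.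
by split; [rewrite -dE | rewrite -gE]; apply/matrixP => i k; rewrite !mxE ?mulrBr.
Qed.
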